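(* Let $p\ge 11$ be a prime, $\beta\in\mathbb{F}_{p^2}^*$ with $\beta^{p-1}=-1$, $\gamma$ a fixed primitive element of $\mathbb{F}_{p^2}$, and $f:\mathbb{F}_{p^2}\to\mathbb{F}_{p^2}$ a planar function with $f(\lambda x)=\lambda^d f(x)$ for all $\lambda\in\mathbb{F}_p$, $x\in\mathbb{F}_{p^2}$ (some fixed positive integer $d$), and $f(1)=1$, $f(\beta)=\beta^2$, $f(\gamma)=\gamma^2$. For $t\in\mathbb{F}_{p^2}^*$ let $$S_t=\left\{\langle \mathrm{Tr}(tx)^2,\ \mathrm{Tr}(f(x)),\ \mathrm{Tr}(\beta f(x))\rangle : x\in\mathbb{F}_{p^2}^*\right\}\subseteq PG(2,p).$$ Then for each $t\neq 0$, $S_t$ is an oval of $PG(2,p)$.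
   Context: $\mathrm{Tr}$ is the trace from $\mathbb{F}_{p^2}$ to $\mathbb{F}_p$; $\langle X_0,X_1,X_2\rangle$ denotes a point of the projective plane $PG(2,p)$ in homogeneous coordinates. A function is planar if for every $a\neq0$ the map $x\mapsto f(x+a)-f(x)-f(a)$ is a permutation. An oval of $PG(2,p)$ is a set of $p+1$ points no three of which are collinear. *)

(* Defs.v *)
From HB Require Import structures.
From mathcomp Require Import all_boot all_order all_fingroup all_algebra all_field.

Set Implicit Arguments.
Unset Strict Implicit.
Unset Printing Implicit Defensive.

Import GRing.Theory.
Local Open Scope ring_scope.

(* Subspaces of a vector space over a finite field form a finite type, so that
   sets of projective points can be handled as {set {vspace _}}. *)
HB.instance Definition _ (K : finFieldType) (vT : vectType K) :=
  isCountable.Build {vspace vT}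
    (pcan_pickleK (can_pcan (@VectorInternalTheory.vs2mxK K vT))).
HB.instance Definition _ (K : finFieldType) (vT : vectType K) :=
  isFinite.Build {vspace vT}
    (pcan_enumP (can_pcan (@VectorInternalTheory.vs2mxK K vT))).

Definition planar (V : zmodType) (f : V -> V) : Prop :=
  forall a, a != 0 -> bijective (fun x => f (x + a) - f x - f a).

Section ProjectivePlane.
Variable K : finFieldType.

(* The points (resp. lines) of PG(2,K) are the subspaces of K^3 of dimension 1
   (resp. 2); hpoint 0 0 0 is the zero subspace, hence not a point. *)
Definition hpoint (a b c : K) : {vspace 'rV[K]_3} :=
  <[\row_(i < 3) [:: a; b; c]`_i]>%VS.

Definition collinear (P Q R : {vspace 'rV[K]_3}) : Prop :=
  exists l : {vspace 'rV[K]_3},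
    \dim l = 2%N /\ [/\ (P <= l)%VS, (Q <= l)%VS & (R <= l)%VS].

Definition is_oval (S : {set {vspace 'rV[K]_3}}) : Prop :=
  [/\ forall P, P \in S -> \dim P = 1%N,
      #|S| = #|K|.+1
    & forall P Q R, P \in S -> Q \in S -> R \in S ->
        P != Q -> P != R -> Q != R -> ~ collinear P Q R].

End ProjectivePlane.

Section Trace.
Variables (K : finFieldType) (L : splittingFieldType K).

(* galTrace takes its values in L, more precisely in the line of 1; abstrace
   reads them in K, see abstraceE. *)
Definition abstrace (x : L) : K :=
  coord [tuple (1 : L)] ord0 (galTrace 1 {:L} x).

Lemma abstraceE (x : L) : (abstrace x)%:A = galTrace 1 {:L} x.
Proof.
have : galTrace 1 {:L} x \in <<[tuple (1%R : L)]>>%VS.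
  by rewrite span_seq1 mem_galTrace ?memvf // finField_galois ?sub1v.
by move/coord_span=> ->; rewrite big_ord1.
Qed.

(* finvect_type L is L with its finite type structure. *)
Definition trace_points (beta : L) (f : L -> L) (t : L) :
    {set {vspace 'rV[K]_3}} :=
  [set hpoint (abstrace (t * x) ^+ 2) (abstrace (f x)) (abstrace (beta * f x))
    | x : finvect_type L & x != 0].

End Trace.

(* Main.v *)
(** A line of PG(2,p) pulls back to the set of zeros of T(c f(x)) - a T(t x)^2.
    Planarity makes g_b(x) = T(c f(x)) + b T(t x) bent: its nonzero differences
    are balanced. The integer counts N(z) = #{x | g_b(x) = z} therefore have
    autocorrelation constant + p^2 delta. In Z[w], w a primitive p-th root of
    unity, this says that A = sum_z N(z) w^z satisfies A conj(A) = p^2; since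
    1 - w is a prime of Z[w] fixed by conjugation and dividing p exactly p - 1
    times, p divides A, and then N takes a single value except at one point, where
    it is shifted by +p or -p. Completing the square expresses the number of zeros
    of T(c f(x)) - a T(t x)^2 through the counts of the g_b and gives at most 2p of
    them. The zeros other than 0 fall into lines over F_p with p - 1 elements
    each, so no three points are collinear.

    For this one needs f to be homogeneous of degree 2. The restriction of f to F_p
    shows that x^d is planar on F_p, so x^d + b x + y^2 is bent on F_p^2, and the
    same value distribution shows that x^d + b x takes no value three times. Then
    1 + x + ... + x^(d-1) permutes F_p when 2 < d < p, against Hermite's criterion. *)

From HB Require Import structures.
Require Import Defs.
From mathcomp Require Import all_boot all_order all_fingroup all_algebra all_field.
From mathcomp Require Import ring lra zify.

Set Implicit Arguments.
Unset Strict Implicit.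
Unset Printing Implicit Defensive.

Import Order.TTheory GRing.Theory Num.Theory.
Local Open Scope ring_scope.

(** * Counting solutions and the quadratic character *)

(** Integer valued, since counts are weighted by signed quantities such as [chi]. *)
Definition cnt {X : finType} {K : eqType} (h : X -> K) (z : K) : int :=
  \sum_x (h x == z)%:R.

Lemma sum_delta (X : finType) (F : X -> int) (a : X) :
  \sum_x (a == x)%:R * F x = F a.
Proof.
rewrite (bigD1 a) //= eqxx mul1r big1 ?addr0 // => x nxa.
by rewrite eq_sym (negbTE nxa) mul0r.
Qed.

Lemma sum_delta1 (X : finType) (a : X) : \sum_x (a == x)%:R = 1 :> int.
Proof.
rewrite (bigD1 a) //= eqxx big1 ?addr0 // => x nxa.
by rewrite eq_sym (negbTE nxa).
Qed.

Lemma cnt_bij (X Y : finType) (K : eqType) (s : X -> Y) (h : Y -> K) (z : K) :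
  bijective s -> cnt (h \o s) z = cnt h z.
Proof. by move=> bs; rewrite /cnt [RHS](reindex s) //; apply: onW_bij. Qed.

Lemma eq_cnt (X : finType) (K : eqType) (h h' : X -> K) (z z' : K) :
  (forall x, (h x == z) = (h' x == z')) -> cnt h z = cnt h' z'.
Proof. by move=> E; apply: eq_bigr => x _; rewrite E. Qed.

Lemma cntE (X : finType) (K : eqType) (h : X -> K) (z : K) :
  cnt h z = #|[pred x | h x == z]|%:R.
Proof. by rewrite -sum1_card natr_sum [RHS]big_mkcond; apply: eq_bigr => x _; rewrite inE; case: eqP. Qed.

Lemma cnt_ge0 (X : finType) (K : eqType) (h : X -> K) (z : K) : 0 <= cnt h z.
Proof. by rewrite cntE ler0n. Qed.

Lemma sum_cnt_mul (X K : finType) (h : X -> K) (F : K -> int) :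
  \sum_z cnt h z * F z = \sum_x F (h x).
Proof.
under eq_bigr => z _ do rewrite mulr_suml.
by rewrite exchange_big; apply: eq_bigr => x _; rewrite sum_delta.
Qed.

Lemma sum_const (X : finType) (a : int) : \sum_(x : X) a = #|X|%:R * a.
Proof. by rewrite sumr_const mulr_natl. Qed.

Lemma sum_cnt (X K : finType) (h : X -> K) : \sum_z cnt h z = #|X|%:R.
Proof.
rewrite exchange_big /= -[RHS]mulr1 -sum_const.
by apply: eq_bigr => x _; rewrite sum_delta1.
Qed.

(** * Correlations of the quadratic character *)

Section QuadraticCharacter.
Variables (p : nat) (p_prime : prime p) (p_gt2 : (2 < p)%N).
Local Notation F := 'F_p.

Lemma card_F : #|F| = p. Proof. exact: card_Fp. Qed.

Lemma two_neq0 : (2%:R : F) != 0.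
Proof. by rewrite -(dvdn_pcharf (pchar_Fp p_prime)) gtnNdvd. Qed.

Definition square_cnt (r w : F) : int := cnt (fun y : F => r * y ^+ 2) w.
(* For r != 0 this is the quadratic character of w / r. *)
Definition chi (r w : F) : int := square_cnt r w - 1.

Lemma chi_sum r : \sum_w chi r w = 0.
Proof. by rewrite big_split /= sum_cnt sumrN sum_const mulr1 subrr. Qed.

Lemma chi_shift_sum r a : \sum_w chi r (w - a) = 0.
Proof.
rewrite -[RHS](chi_sum r) [RHS](reindex (fun w => w - a)) //.
by apply: onW_bij; exists (+%R^~ a) => w; rewrite ?addrNK ?addrK.
Qed.

Lemma chi_le1 (r w : F) : r != 0 -> `|chi r w| <= 1.
Proof.
move=> r0; have := cnt_ge0 (fun y : F => r * y ^+ 2) w.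
suff : square_cnt r w <= 2 by rewrite /chi /square_cnt; move: (cnt _ _) => n; lia.
rewrite /square_cnt cntE natz lez_nat.
have [y /= y2|nos] := pickP [pred y : F | r * y ^+ 2 == w]; last first.
  by rewrite (eq_card0 nos).
apply: leq_trans (card_size [:: y; -y]).
apply: subset_leq_card; apply/subsetP => x /[!inE] x2.
rewrite -eqf_sqr; move: x2; rewrite -(eqP y2) => /eqP/(mulfI r0)/eqP.
by [].
Qed.

(** The products of square counts add up to the number of solutions of r y^2 = r x^2 + a - b. With y
    = x + s this reads r s (2x + s) = a - b: one x for each s != 0, and for s = 0 all x or none. *)
Lemma chi_corr r a b : r != 0 ->
  \sum_z chi r (z - a) * chi r (z - b) = p%:R * (a == b)%:R - 1.
Proof.
move=> r0.
have -> : \sum_z chi r (z - a) * chi r (z - b)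
    = \sum_z square_cnt r (z - a) * square_cnt r (z - b) - p%:R.
  transitivity (\sum_z (square_cnt r (z - a) * square_cnt r (z - b)
      - chi r (z - a) - chi r (z - b) - 1)).
    by apply: eq_bigr => z _; rewrite /chi; ring.
  by rewrite !big_split /= !sumrN !chi_shift_sum sum_const card_F; ring.
have -> : \sum_z square_cnt r (z - a) * square_cnt r (z - b)
    = \sum_z square_cnt r z * square_cnt r (z + a - b).
  rewrite (reindex (fun w => w + a)); last first.
    by apply: onW_bij; exists (+%R^~ (- a)) => w; rewrite ?addrNK ?addrK.
  by apply: eq_bigr => z _; rewrite addrK.
rewrite sum_cnt_mul.
have -> : \sum_x square_cnt r (r * x ^+ 2 + a - b)
   = \sum_s cnt (fun x : F => r * s * (x *+ 2 + s)) (a - b).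
  rewrite [RHS]exchange_big /=; apply: eq_bigr => x _; rewrite /square_cnt /cnt.
  rewrite (reindex (fun s => x + s)); last first.
    by apply: onW_bij; exists (fun w => w - x) => w; ring.
  apply: eq_bigr => s _; congr (_%:R); congr nat_of_bool.
  by rewrite -subr_eq0 -[RHS]subr_eq0; congr (_ == 0); ring.
rewrite (bigD1 0) //= (eq_bigr (fun=> 1)); last first.
  move=> s s0; rewrite -[RHS](sum_delta1 (a - b)) /cnt.
  rewrite [RHS](reindex (fun x : F => r * s * (x *+ 2 + s))) /=.
    by apply: eq_bigr => x _; rewrite eq_sym.
  have n0 := two_neq0.
  apply: onW_bij; exists (fun w => (w / (r * s) - s) / 2%:R) => x; field.
    by rewrite ?n0 ?r0 ?s0.
  by rewrite ?n0 ?r0 ?s0.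
rewrite sumr_const cardC1 card_F /cnt.
under eq_bigr => x _ do rewrite mulr0 mul0r eq_sym subr_eq0.
rewrite sum_const card_F.
have -> : p.-1%:R = p%:R - 1 :> int by rewrite -subn1 natrB // ltnW // ltnW.
ring.
Qed.

(* The autocorrelation of chi is p delta - 1, so adding a square to h can be undone. *)
Lemma cnt_add_square (X : finType) (h : X -> F) (r a : F) : r != 0 ->
  p%:R * cnt h a =
  #|X|%:R + \sum_z chi r (z - a) * cnt (fun q : X * F => h q.1 + r * q.2 ^+ 2) z.
Proof.
move=> r0.
have E z : cnt (fun q : X * F => h q.1 + r * q.2 ^+ 2) z
    = \sum_x (1 + chi r (z - h x)).
  rewrite /cnt -(pair_bigA _ (fun x y => (h x + r * y ^+ 2 == z)%:R)) /=.
  apply: eq_bigr => x _; transitivity (square_cnt r (z - h x)).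
    by apply: eq_cnt => y; rewrite [RHS]eq_sym subr_eq [RHS]eq_sym addrC.
  by rewrite /chi; ring.
under eq_bigr => z _ do rewrite E mulr_sumr.
rewrite exchange_big /=.
under eq_bigr => x _.
  under eq_bigr => z _ do rewrite mulrDr mulr1.
  rewrite big_split /= chi_shift_sum add0r (chi_corr _ _ r0).
  over.
rewrite big_split /= sumrN sum_const mulr1 -mulr_sumr [RHS]addrC subrK /cnt.
by congr (_ * _); apply: eq_bigr => x _; rewrite eq_sym.
Qed.

End QuadraticCharacter.

(** * Integer sequences modulo p with a two-valued autocorrelation *)

Section PrimeCyclotomic.
Variables (p : nat) (p_prime : prime p).
Local Notation F := 'F_p.
Local Notation Phi := ('Phi_p : {poly int}).
Local Notation pZtoC := (map_poly (intr : int -> algC)).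
Local Notation pZtoF := (map_poly (intr : int -> F)).

Lemma cyclotomic_primeM : ('X - 1) * Phi = 'X^p - 1.
Proof.
have Phi1 : 'Phi_1 = 'X - 1 :> {poly int}.
  by have := prod_Cyclotomic (ltnSn 0); rewrite /= big_seq1 expr1.
rewrite -Phi1 -(prod_Cyclotomic (prime_gt0 p_prime)).
have -> : divisors p = [:: 1%N; p].
  apply: (@sorted_eq _ leq leq_trans anti_leq).
  - exact: sorted_divisors.
  - by rewrite /= prime_gt0.
  apply: uniq_perm; first exact: divisors_uniq.
    by rewrite /= inE andbT neq_ltn prime_gt1.
  move=> x; rewrite -dvdn_divisors ?prime_gt0 // !inE.
  by have /primeP[_ H] := p_prime; apply/idP/idP => [/H|/orP[] /eqP->].
by rewrite big_cons big_seq1.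
Qed.

Lemma cyclotomic_prime : Phi = \sum_(i < p) 'X^i.
Proof.
have X1 : 'X - 1 != 0 :> {poly int} by rewrite -size_poly_eq0 size_XsubC.
by apply: (mulfI X1); rewrite cyclotomic_primeM subrX1.
Qed.

Lemma cyclotomic_prime1 : Phi.[1] = p%:R.
Proof.
rewrite cyclotomic_prime horner_sum.
under eq_bigr => i _ do rewrite hornerXn expr1n.
by rewrite sumr_const card_ord.
Qed.

Lemma natF0 : p%:R = 0 :> F.
Proof. by apply/eqP; rewrite -(dvdn_pcharf (pchar_Fp p_prime)). Qed.

Lemma intF_eq0 (n : int) : n%:~R = 0 :> F -> exists m, n = p%:R * m.
Proof.
move/eqP; rewrite -(dvdz_pcharf (pchar_Fp p_prime)) => /dvdzP[m ->].
by exists m; rewrite natz mulrC.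
Qed.

Lemma pZtoF_eq0 (q : {poly int}) : pZtoF q = 0 -> exists h, q = p%:R *: h.
Proof.
move=> q0; have D i : {m | q`_i == p%:R * m}.
  apply: sigW; have := congr1 (coefp i) q0; rewrite /= coef_map coef0.
  by case/intF_eq0=> m ->; exists m.
exists (\poly_(i < size q) sval (D i)).
apply/polyP=> i; rewrite coefZ coef_poly.
case: ltnP => [_|le]; first by case: (D i) => m /= /eqP.
by rewrite nth_default // mulr0.
Qed.

(* In characteristic p, (1 - X)^p = 1 - X^p = (1 - X) Phi. *)
Lemma pZtoF_cyclotomic : pZtoF Phi = (1 - 'X) ^+ p.-1.
Proof.
have X1 : 1 - 'X != 0 :> {poly F}.
  by rewrite -oppr_eq0 opprB -size_poly_eq0 size_XsubC.
apply: (mulfI X1); rewrite -exprS prednK ?prime_gt0 //.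
have := congr1 pZtoF cyclotomic_primeM.
rewrite rmorphM !rmorphB /= map_polyXn map_polyX rmorph1 => E.
have pchF : p \in [pchar {poly F}] by rewrite pchar_poly pchar_Fp.
have -> : (1 - 'X) ^+ p = pFrobenius_aut pchF (1 - 'X) by [].
rewrite rmorphB rmorph1 /= pFrobenius_autE.
by rewrite -[LHS]opprK -mulNr opprB E opprB.
Qed.

(** At [w] this gives (1 - w)^(p-1) = p h(w). The value of [h] at 1, found by putting X = 1, shows
    that h(w) is -1 modulo 1 - w. *)
Lemma expr_1subX : exists h : {poly int},
  (1 - 'X) ^+ p.-1 = Phi + p%:R *: h /\ h.[1] = -1.
Proof.
have /pZtoF_eq0[h hE] : pZtoF ((1 - 'X) ^+ p.-1 - Phi) = 0.
  by rewrite rmorphB rmorphXn rmorphB rmorph1 /= map_polyX pZtoF_cyclotomic subrr.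
exists h; split; first by rewrite -hE [RHS]addrC subrK.
have := congr1 (horner^~ 1) hE; rewrite hornerZ hornerD hornerN cyclotomic_prime1.
rewrite horner_exp !hornerE subrr expr0n -subn1 subn_eq0 leqNgt prime_gt1 //= sub0r.
have p0 : p%:R != 0 :> int by rewrite natz; have := prime_gt0 p_prime; lia.
by move=> E; apply: (mulfI p0); rewrite mulrN1 E.
Qed.

Variables (w : algC) (w_prim : p.-primitive_root w).
Local Notation ev q := (pZtoC q).[w].

Lemma ev_cyclotomic : ev Phi = 0.
Proof.
apply/eqP; rewrite -[_ == _]/(root _ _) (Cintr_Cyclotomic w_prim).
by rewrite root_cyclotomic.
Qed.

(** [Phi] is the minimal polynomial of [w]; as it is monic, division over the rationals stays
    integral. *)
Lemma ev_eq0 (q : {poly int}) : ev q = 0 -> exists r, q = r * Phi.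
Proof.
move=> q0; have [m [mE _ m_min]] := minCpolyP w.
have mPhi : m = map_poly intr Phi.
  apply: (map_poly_inj (ratr : {rmorphism rat -> algC})); rewrite -mE.
  rewrite (minCpoly_cyclotomic w_prim) -(Cintr_Cyclotomic w_prim) -map_poly_comp.
  by apply: eq_map_poly => x /=; rewrite ratr_int.
have : m %| map_poly intr q.
  rewrite -m_min -map_poly_comp; apply/eqP; rewrite -[RHS]q0; congr (_.[w]).
  by apply: eq_map_poly => x /=; rewrite ratr_int.
by rewrite mPhi dvdp_rat_int => /(Pdiv.IdomainMonic.dvdpP (Cyclotomic_monic p)).
Qed.

Lemma mul_prim_conj : w * w^* = 1.
Proof.
rewrite -normCK; suff -> : `|w| = 1 by rewrite expr1n.
apply/eqP; rewrite -(@pexpr_eq1 _ `|w| p) ?normr_ge0 ?prime_gt0 //.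
by rewrite -normrX (prim_expr_order w_prim) normr1.
Qed.

(** The conjugate of [w] is w^(p-1). Relations that involve conjugates thus become relations between
    integer polynomials, to which [ev_eq0] applies. *)
Lemma conj_ev (q : {poly int}) : (ev q)^* = ev (q \Po 'X^(p.-1)).
Proof.
have w0 : w != 0 by rewrite (prim_root_eq0 w_prim) -lt0n prime_gt0.
have w1 : w^* = w ^+ p.-1.
  apply: (mulfI w0); rewrite mul_prim_conj -exprS prednK ?prime_gt0 //.
  by rewrite (prim_expr_order w_prim).
rewrite map_comp_poly /= map_polyXn horner_comp hornerXn -w1 -horner_map /=.
congr (_.[_]); rewrite -map_poly_comp; apply: eq_map_poly => x /=.
by rewrite rmorph_int.
Qed.

Lemma ev_1subX : ev (1 - 'X) = 1 - w.
Proof. by rewrite rmorphB rmorph1 /= map_polyX !hornerE. Qed.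

Lemma evM q1 q2 : ev (q1 * q2) = ev q1 * ev q2.
Proof. by rewrite rmorphM hornerM. Qed.

Lemma evX q n : ev (q ^+ n) = ev q ^+ n.
Proof. by rewrite rmorphXn horner_exp. Qed.

(* For k < p - 1, the product of q(w) and its conjugate is a multiple of 1 - w.
   Reduction modulo 1 - w sends w and its conjugate to 1, so p divides q(1)^2,
   hence q(1), and therefore 1 - w divides q(w). *)
Lemma cyclotomic_descent (C : {poly int}) k :
  ev C * (ev C)^* = p%:R ^+ 2 -> (k <= p.-1)%N ->
  exists q, ev C = (1 - w) ^+ k * ev q.
Proof.
move=> CC; elim: k => [|k IH] kp; first by exists C; rewrite expr0 mul1r.
have [q Cq] := IH (ltnW kp).
have [h [hE h1]] := expr_1subX.
(* The [m.+1] factors 1 - w still missing from the exponent p - 1; there is at least one, so the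
   term subtracted below vanishes at 1. *)
pose m := (p.-1 - k.+1)%N.
have aH : (1 - w) ^+ (k + m.+1) = p%:R * ev h.
  have -> : (k + m.+1 = p.-1)%N by rewrite /m; lia.
  rewrite -ev_1subX -evX hE -mul_polyC polyC_natr rmorphD hornerD ev_cyclotomic.
  by rewrite add0r evM rmorph_nat -polyC_natr hornerC.
have aH' : (1 - w)^* ^+ (k + m.+1) = p%:R * (ev h)^*.
  by rewrite -rmorphXn aH rmorphM rmorph_nat.
pose Y : {poly int} := 'X^(p.-1).
have /ev_eq0[r rE] : ev (h * (h \Po Y) * (q * (q \Po Y))
    - (1 - 'X) ^+ m.+1 * ((1 - 'X) ^+ m.+1 \Po Y)) = 0.
  rewrite rmorphB hornerD hornerN !evM -!conj_ev !evX ev_1subX rmorphXn.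
  have p0 : p%:R ^+ 2 != 0 :> algC.
    by rewrite expf_eq0 /= pnatr_eq0 -lt0n prime_gt0.
  apply: (mulfI p0); rewrite mulr0 mulrBr.
  apply/eqP; rewrite subr_eq0; apply/eqP.
  transitivity ((1 - w) ^+ (k + m.+1) * (1 - w)^* ^+ (k + m.+1) * (ev q * (ev q)^*)).
    by rewrite aH aH'; ring.
  by rewrite -CC Cq rmorphM rmorphXn !exprD /=; ring.
have q1 : exists l, q.[1] = p%:R * l.
  apply: intF_eq0; apply/eqP; rewrite -sqrf_eq0 -rmorphXn /=.
  have := congr1 (horner^~ 1) rE; rewrite /= hornerM cyclotomic_prime1.
  rewrite !(hornerE, horner_comp, horner_exp, expr1n, subrr, expr0n) /= h1.
  move=> E.
  have -> : q.[1] ^+ 2 = r.[1] * p%:R by rewrite -E; ring.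
  by rewrite rmorphM rmorph_nat natF0 mulr0.
have [l ql] := q1.
have /factor_theorem[q' q'E] : root (q - (q.[1])%:P) 1.
  by rewrite /root !hornerE subrr.
have /factor_theorem[f fE] : root (Phi - p%:R%:P) 1.
  by rewrite /root !hornerE cyclotomic_prime1 subrr.
have qE : q = q' * ('X - 1) + (p%:R * l)%:P by rewrite -ql -q'E subrK.
have PhiE : Phi = f * ('X - 1) + (p%:R)%:P by rewrite -fE subrK.
(* Subtracting [l] times [Phi] changes nothing at [w] and removes the value p l at 1. *)
have E : q - l%:P * Phi = (1 - 'X) * (f * l%:P - q').
  by rewrite [in LHS]qE PhiE polyCM; ring.
exists (f * l%:P - q'); rewrite exprSr -mulrA Cq; congr (_ * _).
rewrite -ev_1subX -evM -E.
by rewrite rmorphB hornerD hornerN evM ev_cyclotomic mulr0 subr0.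
Qed.

(* Modulo p the polynomial C is a multiple of Phi, and by its size a constant multiple. *)
Lemma cyclotomic_constant (C : {poly int}) :
  (size C <= p)%N -> ev C * (ev C)^* = p%:R ^+ 2 ->
  exists a : int, forall i, (i < p)%N -> exists b, C`_i = a + p%:R * b.
Proof.
move=> sC CC; have [q Cq] := cyclotomic_descent CC (leqnn _).
have [h [hE _]] := expr_1subX.
have /ev_eq0[r rE] : ev (C - p%:R *: (h * q)) = 0.
  rewrite -mul_polyC polyC_natr rmorphB hornerD hornerN !evM Cq rmorph_nat.
  rewrite -polyC_natr hornerC -ev_1subX -evX hE -mul_polyC polyC_natr.
  rewrite rmorphD hornerD ev_cyclotomic add0r evM rmorph_nat -polyC_natr hornerC.
  ring.
have PhiE : pZtoF Phi = \sum_(i < p) 'X^i.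
  by rewrite cyclotomic_prime rmorph_sum /=; apply: eq_bigr => i _; rewrite map_polyXn.
have CE : pZtoF C = pZtoF r * pZtoF Phi.
  rewrite -rmorphM -rE rmorphB -mul_polyC polyC_natr rmorphM rmorph_nat /=.
  by rewrite -polyC_natr natF0 polyC0 mul0r subr0.
have sPhi : size (pZtoF Phi) = p.
  rewrite pZtoF_cyclotomic -[RHS](prednK (prime_gt0 p_prime)).
  by rewrite -opprB exprNn -signr_odd size_Msign size_exp_XsubC.
have sr : (size (pZtoF r) <= 1)%N.
  have [->|r0] := eqVneq (pZtoF r) 0; first by rewrite size_poly0.
  have : (size (pZtoF C) <= p)%N by apply: leq_trans sC; apply: size_poly.
  have Phi0 : pZtoF Phi != 0 by rewrite -size_poly_eq0 sPhi -lt0n prime_gt0.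
  by rewrite CE size_mul // sPhi -subn1 leq_subLR leq_add2r.
exists C`_0 => i ip.
suff /intF_eq0[b bE] : (C`_i - C`_0)%:~R = 0 :> F by exists b; rewrite -bE addrC subrK.
have Ci j : (j < p)%N -> (C`_j)%:~R = (pZtoF r)`_0 :> F.
  move=> jp; rewrite -coef_map /= CE (size1_polyC sr) coefCM coefC eqxx.
  rewrite PhiE coef_sum (bigD1 (Ordinal jp)) //= coefXn eqxx big1 ?addr0 ?mulr1 //.
  by move=> l lj; rewrite coefXn -(inj_eq val_inj) /= in lj *; rewrite eq_sym (negbTE lj).
by rewrite rmorphB /= !Ci ?subrr ?prime_gt0.
Qed.

Lemma prim_exprD (z z' : F) : w ^+ (z + z')%R = w ^+ z * w ^+ z'.
Proof.
rewrite -exprD -[RHS](prim_expr_mod w_prim); congr (w ^+ _).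
by rewrite /=; congr (_ %% _)%N; apply: Fp_cast.
Qed.

Lemma prim_expr_sum : \sum_(z : F) w ^+ z = 0.
Proof.
have w1 : w - 1 != 0.
  rewrite subr_eq0; apply/eqP => w1; have := prim_order_dvd w_prim 1.
  by rewrite expr1 w1 eqxx dvdn1; have := prime_gt1 p_prime; case: p => [|[]].
apply: (mulfI w1); rewrite mulr0 mulrBl mul1r; apply/eqP; rewrite subr_eq0; apply/eqP.
rewrite [RHS](reindex (+%R 1)); last first.
  by apply: onW_bij; exists (fun z => z - 1) => z; ring.
rewrite mulr_sumr; apply: eq_bigr => z _; by rewrite prim_exprD.
Qed.

Lemma prim_expr_conj (z : F) : (w ^+ z)^* * w ^+ z = 1.
Proof. by rewrite rmorphXn /= -exprMn [X in X ^+ _]mulrC mul_prim_conj expr1n. Qed.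

End PrimeCyclotomic.

(** * From the autocorrelation to the values *)

Section Autocorrelation.
Variables (p : nat) (p_prime : prime p).
Local Notation F := 'F_p.
Variables (c : F -> int) (K : int).
Hypothesis c_corr :
  forall k, \sum_z c z * c (z + k) = K + p%:R ^+ 2 * (k == 0)%:R.

(** In A conj(A) the constant [K] is multiplied by the sum of all w^k, which is 0, so only p^2
    survives and [cyclotomic_constant] applies. *)
Lemma autocorr_constant : exists a : int, forall z, exists b, c z = a + p%:R * b.
Proof.
have [w w_prim] := C_prim_root_exists (prime_gt0 p_prime).
have ltF (z : F) : (z < p)%N by apply: leq_trans (ltn_ord z) _; rewrite Fp_cast.
pose C : {poly int} := \sum_z c z *: 'X^z.
have sC : (size C <= p)%N.
  apply: leq_trans (size_sum _ _ _) _; apply/bigmax_leqP => z _.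
  by apply: leq_trans (size_scale_leq _ _) _; rewrite size_polyXn.
have evC : (map_poly intr C).[w] = \sum_z (c z)%:~R * w ^+ z.
  rewrite rmorph_sum horner_sum /=; apply: eq_bigr => z _.
  by rewrite -mul_polyC rmorphM /= map_polyXn map_polyC hornerM hornerC hornerXn.
have CC : (map_poly intr C).[w] * ((map_poly intr C).[w])^* = p%:R ^+ 2.
  rewrite evC rmorph_sum mulr_sumr.
  transitivity (\sum_z' \sum_k (c z' * c (z' + k))%:~R * w ^+ k : algC).
    apply: eq_bigr => z' _; rewrite mulr_suml (reindex (+%R z')); last first.
      by apply: onW_bij; exists (fun z => z - z') => z; ring.
    apply: eq_bigr => k _; rewrite (prim_exprD p_prime w_prim) !rmorphM /= !rmorph_int.
    by rewrite -[RHS]mul1r -(prim_expr_conj p_prime w_prim z'); ring.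
  rewrite exchange_big /=.
  under eq_bigr => k _ do rewrite -mulr_suml -rmorph_sum /= c_corr rmorphD mulrDl.
  rewrite big_split /= -mulr_sumr prim_expr_sum // mulr0 add0r (bigD1 0) //=.
  rewrite big1 ?addr0 => [|k /negbTE->]; last by rewrite mulr0 mul0r.
  by rewrite !mulr1 rmorphXn /= rmorph_nat.
have [a aE] := cyclotomic_constant p_prime w_prim sC CC.
exists a => z; have [b bE] := aE _ (ltF z); exists b; rewrite -bE.
rewrite coef_sum (bigD1 z) //= coefZ coefXn eqxx mulr1 big1 ?addr0 // => z' z'z.
by rewrite coefZ coefXn (inj_eq val_inj) eq_sym (negbTE z'z) mulr0.
Qed.

(* After division by p the differences e z - e (z + k) have square sum 2, so that
   summing over k some e z0 differs from only one other value, by 1. *)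
Lemma autocorr_delta : exists (a e : int) (k : F),
  (e = 1 \/ e = -1) /\ forall z, c z = a + e * p%:R * (z == k)%:R.
Proof.
have [a aE] := autocorr_constant.
have D z : {b | c z == a + p%:R * b}.
  by apply: sigW; have [b ->] := aE z; exists b.
pose e z := sval (D z).
have cE z : c z = a + p%:R * e z by rewrite /e; case: (D z) => b /= /eqP.
have p0 : p%:R ^+ 2 != 0 :> int by rewrite expf_eq0 /= natz; have := prime_gt0 p_prime; lia.
have sumF (G : F -> int) k : \sum_z G (z + k) = \sum_z G z.
  rewrite [RHS](reindex (+%R^~ k)) //.
  by apply: onW_bij; exists (fun z => z - k) => z; ring.
(* When the square is expanded, [K] cancels between the shifts 0 and [k], and 2 p^2 is left. *)
have e2 k : k != 0 -> \sum_z (e z - e (z + k)) ^+ 2 = 2.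
  move=> k0; apply: (mulfI p0); rewrite mulr_sumr.
  transitivity (\sum_z (c z * c (z + 0) + c (z + k) * c (z + k + 0) - (c z * c (z + k)) *+ 2)).
    by apply: eq_bigr => z _; rewrite !addr0 !cE; ring.
  rewrite big_split /= sumrN big_split /= (sumF (fun z => c z * c (z + 0))) !c_corr eqxx.
  by rewrite sumrMnl c_corr (negbTE k0) /=; ring.
have e_total : \sum_z \sum_z' (e z - e z') ^+ 2 = p%:R * 2 - 2.
  transitivity (\sum_z \sum_k (e z - e (z + k)) ^+ 2).
    by apply: eq_bigr => z _; rewrite -[LHS](sumF (fun y => (e z - e y) ^+ 2) z);
      apply: eq_bigr => k _; rewrite [k + z]addrC.
  rewrite exchange_big (bigD1 0) //= big1 ?add0r => [|z _]; last by rewrite addr0 subrr.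
  rewrite (eq_bigr (fun=> 2)) => [|k /e2 //].
  rewrite sumr_const cardC1 card_Fp // -subn1 mulrnBr ?prime_gt0 // mulr1n.
  by rewrite mulr_natl.
(* The total 2p - 2 is spread over p inner sums. *)
have [z0 z0P] : exists z0, \sum_z (e z0 - e z) ^+ 2 < 2.
  apply/existsP; apply: contraLR isT; rewrite negb_exists => /forallP H.
  have : \sum_(z : F) 2 <= p%:R * 2 - 2 :> int.
    by rewrite -e_total; apply: ler_sum => z _; rewrite leNgt.
  by rewrite sum_const card_Fp //; lia.
have [k kP|all0] := pickP [pred k | e z0 != e k]; last first.
  have := e2 1 (oner_neq0 _); rewrite big1 // => z _.
  by have /eqP<- := negbFE (all0 z); have /eqP<- := negbFE (all0 (z + 1)); rewrite subrr.
move: z0P; rewrite (bigD1 k) //= => z0P.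
have rest_ge0 : 0 <= \sum_(i | i != k) (e z0 - e i) ^+ 2 by apply: sumr_ge0 => i _; apply: sqr_ge0.
have d0 : e k - e z0 != 0 by rewrite subr_eq0 eq_sym.
have d2 : (e k - e z0 = 1 \/ e k - e z0 = -1) /\ \sum_(i | i != k) (e z0 - e i) ^+ 2 = 0.
  set S := (X in X = 0); rewrite -/S in z0P rest_ge0.
  by move: z0P rest_ge0 d0; move: S (e k) (e z0) => S u v; nia.
exists (a + p%:R * e z0), (e k - e z0), k; split; first exact: d2.1.
move=> z; rewrite cE; have [->|zk] := eqVneq z k; first by rewrite mulr1; ring.
have /eqP := d2.2; rewrite psumr_eq0 => [|i _]; last exact: sqr_ge0.
move=> /allP/(_ z (mem_index_enum _)); rewrite zk /= sqrf_eq0 subr_eq0 => /eqP->.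
by rewrite mulr0 addr0.
Qed.

End Autocorrelation.

(** * Value distribution of bent functions *)

HB.instance Definition _ (U V : finZmodType) := Finite.on (U * V)%type.

Section Bent.
Variables (p : nat) (p_prime : prime p).
Local Notation F := 'F_p.

(** The differences are balanced when [V] has p^2 elements, which is where the value p comes
    from. *)
Definition bent (V : finZmodType) (phi : V -> F) : Prop :=
  forall a, a != 0 -> forall z, cnt (fun x => phi (x + a) - phi x) z = p%:R.

(** The autocorrelation of the counts sorts pairs of arguments by their difference: 0 contributes
    p^2 at shift 0, each of the other p^2 - 1 differences contributes p. The total p^2 then fixes
    the constant as p - e. *)
Lemma bent_cnt (V : finZmodType) (phi : V -> F) :
  #|V| = (p ^ 2)%N -> bent phi ->
  exists (e : int) (k : F), (e = 1 \/ e = -1) /\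
    forall z, cnt phi z = p%:R - e + e * p%:R * (z == k)%:R.
Proof.
move=> cardV phi_bent.
have corr k : \sum_z cnt phi z * cnt phi (z + k)
    = (p%:R ^+ 3 - p%:R) + p%:R ^+ 2 * (k == 0)%:R.
  rewrite sum_cnt_mul.
  transitivity (\sum_a cnt (fun x => phi (x + a) - phi x) k).
    rewrite [RHS]exchange_big; apply: eq_bigr => x _.
    rewrite /cnt (reindex (+%R x)) /=; last first.
      by apply: onW_bij; exists (fun z => z - x) => z; rewrite addrC ?addKr ?addrNK ?addrK.
    by apply: eq_bigr => a _; rewrite subr_eq [k + _]addrC.
  rewrite (bigD1 0) //= (eq_bigr (fun=> p%:R)) => [|a a0]; last exact: phi_bent.
rewrite sumr_const cardC1 cardV.
  have -> : cnt (fun x : V => phi (x + 0) - phi x) k = p%:R ^+ 2 * (k == 0)%:R.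
    rewrite /cnt; under eq_bigr => x _ do rewrite addr0 subrr eq_sym.
    by rewrite sum_const cardV natrX.
  rewrite -subn1 mulrnBr ?expn_gt0 ?prime_gt0 // -[_ *+ (p ^ 2)]mulr_natr natrX mulr1n.
  ring.
have [a [e [k [e1 cE]]]] := autocorr_delta p_prime corr.
exists e, k; split=> // z; rewrite cE; congr (_ + _).
have := sum_cnt phi; rewrite (eq_bigr _ (fun z _ => cE z)) big_split /= sum_const.
rewrite -mulr_sumr; under [X in _ + _ * X]eq_bigr => i _ do rewrite eq_sym.
rewrite sum_delta1 card_Fp // cardV natrX mulr1 => E.
have p0 : p%:R != 0 :> int by rewrite natz; have := prime_gt0 p_prime; lia.
by apply: (mulfI p0); rewrite mulrBr -expr2 -E; ring.
Qed.

(* The function phi x + y^2 is bent on F x F. *)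
Lemma planar_fp_cnt (phi : F -> F) (z : F) : (2 < p)%N ->
  (forall a, a != 0 -> injective (fun x => phi (x + a) - phi x)) ->
  cnt phi z <= 2.
Proof.
move=> p_gt2 phi_planar.
pose psi (q : F * F) : F := phi q.1 + 1 * q.2 ^+ 2.
have psi_bent : bent (V := (F * F)%type) psi.
  move=> [a b] ab w; rewrite /psi /cnt.
  rewrite -(pair_bigA _ (fun x y => ((phi (x + a) + 1 * (y + b) ^+ 2 - (phi x + 1 * y ^+ 2)) == w)%:R)) /=.
  have [b0|b0] := eqVneq b 0.
    have a0 : a != 0 by apply: contraNneq ab => ->; rewrite b0.
    rewrite exchange_big /= (eq_bigr (fun=> 1)); first by rewrite sum_const card_Fp ?mulr1.
    move=> y _; rewrite -[RHS](sum_delta1 w) [RHS](reindex (fun x => phi (x + a) - phi x)) /=.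
      by apply: eq_bigr => x _; rewrite b0 eq_sym; congr (_ == _)%:R; ring.
    by apply: onW_bij; apply: injF_bij; apply: phi_planar.
  rewrite (eq_bigr (fun=> 1)); first by rewrite sum_const card_Fp ?mulr1.
  move=> x _; rewrite -[RHS](sum_delta1 w).
  rewrite [RHS](reindex (fun y => phi (x + a) - phi x + b * (y *+ 2 + b))) /=.
    by apply: eq_bigr => y _; rewrite eq_sym; congr (_ == _)%:R; ring.
  have n0 := two_neq0 p_prime p_gt2.
  apply: onW_bij; exists (fun w => ((w - (phi (x + a) - phi x)) / b - b) / 2%:R) => y; field;
  by rewrite ?n0 ?b0.
have [|e [k [e1 psiE]]] := bent_cnt _ psi_bent.
  by rewrite card_prod card_Fp // mulnn.
(* Summed against [chi], the constant part of the distribution of [psi] drops out; the exceptional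
   value [k] gives the count 1 + e chi(k - z). *)
have := cnt_add_square p_prime p_gt2 phi z (oner_neq0 _).
rewrite -/psi (eq_bigr (fun w => chi 1 (w - z) * (p%:R - e) +
  e * p%:R * ((k == w)%:R * chi 1 (w - z)))); last first.
  by move=> w _; rewrite psiE [k == w]eq_sym; ring.
rewrite big_split /= -mulr_suml chi_shift_sum // mul0r add0r -mulr_sumr sum_delta card_Fp // => E.
have p0 : p%:R != 0 :> int by rewrite natz; have := prime_gt0 p_prime; lia.
have -> : cnt phi z = 1 + e * chi 1 (k - z) by apply: (mulfI p0); rewrite E; ring.
have := chi_le1 p_prime p_gt2 (k - z) (oner_neq0 _).
by case: e1 => ->; move: (chi _ _) => u; lia.
Qed.

End Bent.

(** * Zeros of g - a u^2 *)

Section BentConic.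
Variables (p : nat) (p_prime : prime p) (p_gt2 : (2 < p)%N).
Local Notation F := 'F_p.

Lemma chi_sum_cnt (h : F -> int) (a e : int) (k r : F) :
  (forall z, h z = a + e * (z == k)%:R) ->
  \sum_z chi r z * h z = e * chi r k.
Proof.
move=> hE; rewrite (eq_bigr (fun z => a * chi r z + e * ((k == z)%:R * chi r z))).
  by rewrite big_split /= -!mulr_sumr chi_sum sum_delta mulr0 add0r.
by move=> z _; rewrite hE [k == z]eq_sym; ring.
Qed.

(* Completing the square in g + y u + r y^2, with r = 1/(4a), separates
   g - a u^2 from the quadratic term. *)
Lemma bent_conic_cnt (V : finLmodType F) (g u : V -> F) (a : F) :
  #|V| = (p ^ 2)%N ->
  (forall l x, g (l *: x) = l ^+ 2 * g x) ->
  (forall l x, u (l *: x) = l * u x) ->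
  (forall b, bent (fun x => g x + b * u x)) ->
  cnt (fun x => g x - a * u x ^+ 2) 0 <= p%:R * 2.
Proof.
move=> cardV g_hom u_hom gu_bent.
have p3 : 3%:R <= p%:R :> int by rewrite ler_nat.
have [e0 [k0 [e01 cnt0]]] := bent_cnt p_prime cardV (gu_bent 0).
(* Here 1/(4a) does not exist, but the count is that of the bent function [g] itself. *)
have [a0|a0] := eqVneq a 0.
  have -> : cnt (fun x => g x - a * u x ^+ 2) 0 = cnt (fun x => g x + 0 * u x) 0.
    by apply: eq_cnt => x; rewrite a0 !mul0r subr0 addr0.
  rewrite cnt0; move: p3; move: (p%:R : int) => n n3.
  by case: e01 => ->; case: eqP => _; rewrite ?mulr0 ?mulr1; lia.
have [e [k [e1 cnt1]]] := bent_cnt p_prime cardV (gu_bent 1).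
have n2 := two_neq0 p_prime p_gt2.
have n4 : 4%:R != 0 :> F by rewrite (natrM _ 2 2) mulf_neq0.
pose r := (4%:R * a)^-1.
have r0 : r != 0 by rewrite invr_neq0 // mulf_neq0.
(* The shift y -> y + 2a u(x) turns r y^2 into r y^2 + y u(x) + a u(x)^2. *)
have PhiE z : cnt (fun q : V * F => g q.1 - a * u q.1 ^+ 2 + r * q.2 ^+ 2) z
    = \sum_y cnt (fun x => g x + y * u x) (z - r * y ^+ 2).
  rewrite [RHS]exchange_big /= /cnt.
  rewrite -(pair_bigA _ (fun x y => (g x - a * u x ^+ 2 + r * y ^+ 2 == z)%:R)) /=.
  apply: eq_bigr => x _.
  rewrite (reindex (fun y => y + u x * (2%:R * a))) /=; last first.
    by apply: onW_bij; exists (fun y => y - u x * (2%:R * a)) => y; ring.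
  apply: eq_bigr => y _; congr (nat_of_bool _)%:R.
  by rewrite -subr_eq0 -[RHS]subr_eq0; congr (_ == 0); rewrite /r; field; rewrite a0.
(* Replacing x by y x multiplies g + u by y^2, so all y != 0 share the same [e] and [k]. *)
have cnty y z : y != 0 -> cnt (fun x => g x + y * u x) (z - r * y ^+ 2)
    = p%:R - e + e * p%:R * (z == (k + r) * y ^+ 2)%:R.
  move=> y0; transitivity (cnt (fun x => g x + 1 * u x) ((z - r * y ^+ 2) / y ^+ 2)).
    rewrite -(@cnt_bij _ _ _ (fun x => y *: x) (fun x => g x + y * u x)).
      apply: eq_cnt => x /=; rewrite g_hom u_hom mul1r [RHS]eq_sym.
      rewrite -[RHS](inj_eq (mulfI (expf_neq0 2 y0))) [RHS]eq_sym.
      by rewrite -subr_eq0 -[RHS]subr_eq0; congr (_ == 0); field.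
    by exists (fun x => y^-1 *: x) => x; rewrite scalerA ?mulVf ?mulfV ?scale1r.
  rewrite cnt1; congr (_ + _ * (nat_of_bool _)%:R).
  rewrite -[LHS](inj_eq (mulfI (expf_neq0 2 y0))).
  by rewrite -subr_eq0 -[RHS]subr_eq0; congr (_ == 0); field.
have := cnt_add_square p_prime p_gt2 (fun x => g x - a * u x ^+ 2) 0 r0.
under eq_bigr => z _ do rewrite subr0 PhiE mulr_sumr.
rewrite exchange_big /= cardV (bigD1 0) //=.
rewrite (@chi_sum_cnt _ (p%:R - e0) (e0 * p%:R) k0); last first.
  by move=> z; rewrite -cnt0; congr cnt; rewrite expr0n mulr0 subr0.
rewrite (eq_bigr (fun y => e * p%:R * chi r ((k + r) * y ^+ 2))) => [|y y0]; last first.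
  by apply: (@chi_sum_cnt _ (p%:R - e)) => z; apply: cnty.
rewrite -mulr_sumr natrX => E.
have p0 : p%:R != 0 :> int by move: p3; case: eqP => // ->.
have -> : cnt (fun x => g x - a * u x ^+ 2) 0
    = p%:R + e0 * chi r k0 + e * \sum_(y | y != 0) chi r ((k + r) * y ^+ 2).
  by apply: (mulfI p0); rewrite E; ring.
(* The three terms are bounded by p, 1 and p - 1, which add up to 2p. *)
have B : `|\sum_(y | y != 0) chi r ((k + r) * y ^+ 2)| <= p%:R - 1.
  apply: le_trans (ler_norm_sum _ _ _) _.
  apply: (@le_trans _ _ (\sum_(y : F | y != 0) 1)).
    by apply: ler_sum => y _; apply: chi_le1.
  by rewrite sumr_const cardC1 card_Fp // -subn1 mulrnBr ?prime_gt0.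
have := chi_le1 p_prime p_gt2 k0 r0.
move: B; move: (\sum_(y | _) _) (chi r k0) => S v.
by case: e01 => ->; case: e1 => ->; lia.
Qed.

End BentConic.

(** * Planar monomials over the prime field *)

Section PlanarMonomial.
Variables (p : nat) (p_prime : prime p) (p_gt2 : (2 < p)%N).
Local Notation F := 'F_p.

Lemma Fp_expr_p1 (x : F) : x != 0 -> x ^+ p.-1 = 1.
Proof.
move=> x0; apply: (mulfI x0); rewrite -exprS prednK ?prime_gt0 // mulr1.
by have := expf_card x; rewrite card_Fp.
Qed.

Lemma Fp_expr_modp1 (x : F) (n m : nat) :
  x != 0 -> n = m %[mod p.-1] -> x ^+ n = x ^+ m.
Proof.
move=> /Fp_expr_p1 x1 nm; rewrite (divn_eq n p.-1) (divn_eq m p.-1) nm.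
by rewrite !exprD !(mulnC _ p.-1) !exprM x1 !expr1n.
Qed.

(** Some g != 0 has g^n != 1, by the bound on the number of roots of unity; the substitution x -> g
    x multiplies the sum by g^n. *)
Lemma power_sum (n : nat) : ~~ (p.-1 %| n)%N -> \sum_(x : F) x ^+ n = 0.
Proof.
move=> pn; set m := (n %% p.-1)%N.
have m0 : (0 < m)%N by rewrite lt0n.
have mp : (m < p.-1)%N by rewrite ltn_mod -ltnS prednK ?prime_gt0 // prime_gt1.
have [g g0 gn] : exists2 g : F, g != 0 & g ^+ n != 1.
  have [g /andP[g0 gn]|all1] := pickP [pred g : F | (g != 0) && (g ^+ n != 1)]; first by exists g.
  have /(max_unity_roots m0) : all m.-unity_root (enum (predC1 (0 : F))).
    apply/allP => x; rewrite mem_enum inE => x0; apply/unity_rootP.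
    have := all1 x; rewrite /= x0 /= => /negbFE/eqP <-.
    by apply: Fp_expr_modp1 => //; rewrite modn_mod.
  by rewrite enum_uniq -cardE cardC1 card_Fp // => /(_ isT); rewrite leqNgt mp.
have gn1 : g ^+ n - 1 != 0 by rewrite subr_eq0.
apply: (mulfI gn1); rewrite mulr0 mulrBl mul1r; apply/eqP; rewrite subr_eq0; apply/eqP.
rewrite [RHS](reindex (fun x => g * x)); last first.
  by apply: onW_bij; exists (fun x => g^-1 * x) => x; rewrite mulrA ?mulVf ?mulfV ?mul1r.
by rewrite mulr_sumr; apply: eq_bigr => x _; rewrite exprMn.
Qed.

Lemma power_sum_dvd (n : nat) : (0 < n)%N -> (p.-1 %| n)%N -> \sum_(x : F) x ^+ n = -1.
Proof.
move=> n0 pn; rewrite (bigD1 0) //= expr0n eqn0Ngt n0 add0r.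
rewrite (eq_bigr (fun=> 1)) => [|x x0].
  rewrite sumr_const cardC1 card_Fp // -subn1 natrB ?prime_gt0 //.
  by rewrite natF0 // sub0r.
by rewrite (@Fp_expr_modp1 _ _ 0) //; apply/eqP; rewrite mod0n.
Qed.

Lemma sum_horner (T : {poly F}) :
  T`_0 = 0 -> (size T <= (2 * p.-1).+1)%N ->
  \sum_x T.[x] = - (T`_(p.-1) + T`_(2 * p.-1)).
Proof.
move=> T0 sT.
under eq_bigr => x _ do rewrite (horner_coef_wide _ sT).
rewrite exchange_big /=; under eq_bigr => i _ do rewrite -mulr_sumr.
have lt1 : (p.-1 < (2 * p.-1).+1)%N by lia.
have lt2 : (2 * p.-1 < (2 * p.-1).+1)%N by lia.
rewrite (bigD1 (Ordinal lt1)) //= (bigD1 (Ordinal lt2)) /=; last first.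
  by rewrite -(inj_eq val_inj) /=; lia.
rewrite !power_sum_dvd ?dvdnn ?dvdn_mull //; try lia.
rewrite big1 ?addr0 => [|i /andP[i1 i2]]; first by ring.
have [i0|i0] := posnP i; first by rewrite i0 T0 mul0r.
rewrite power_sum ?mulr0 //; apply: contra i1 => /dvdnP[m im].
move: i2; rewrite -!(inj_eq val_inj) /= => i2.
have := ltn_ord i; rewrite ltnS im leq_pmul2r; last by lia.
case: m im => [|[|[|m]]] im //; first lia.
- by rewrite mul1n.
- by rewrite im eqxx in i2.
Qed.

Definition geom (d : nat) : {poly F} := \sum_(i < d) 'X^i.

Lemma coef_geom (d i : nat) : (geom d)`_i = (i < d)%:R.
Proof.
rewrite /geom coef_sum; under eq_bigr => j _ do rewrite coefXn.
have [id|di] := ltnP i d.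
  rewrite (bigD1 (Ordinal id)) //= eqxx big1 ?addr0 // => j ji.
  by rewrite -(inj_eq val_inj) /= eq_sym in ji; rewrite (negbTE ji).
by rewrite big1 // => j _; have := ltn_ord j; case: eqP => // <-; rewrite ltnNge di.
Qed.

(** Below degree d, [geom d] agrees with the series of 1/(1 - X). *)
Lemma coef_geom_exp (d k i : nat) : (i < d)%N -> (geom d ^+ k.+1)`_i = 'C(i + k, k)%:R.
Proof.
elim: k i => [|k IH] i id; first by rewrite expr1 coef_geom id bin0.
rewrite exprS coefMr.
transitivity (\sum_(j < i.+1) 'C(j + k, k)%:R : F).
  apply: eq_bigr => j _; rewrite coef_geom IH; last by have := ltn_ord j; lia.
  by rewrite (leq_ltn_trans (leq_subr _ _) id) mul1r.
rewrite -natr_sum; congr (_%:R); elim: {id} i => [|i IHi].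
  by rewrite big_ord1 !add0n !binn.
by rewrite big_ord_recr IHi /= [(i.+1 + k)%N]addSnnS [in RHS]addSn binS.
Qed.

Lemma geom_monic (d : nat) : (0 < d)%N -> size (geom d) = d /\ geom d \is monic.
Proof.
move=> d0; have sg : size (geom d) = d.
  apply/eqP; rewrite eqn_leq; apply/andP; split.
    by apply/leq_sizeP => j dj; rewrite coef_geom ltnNge dj.
  rewrite leqNgt -(prednK d0) ltnS; apply/negP => /leq_sizeP/(_ _ (leqnn _))/eqP.
  by rewrite coef_geom prednK // leqnn oner_eq0.
by split=> //; rewrite monicE lead_coefE sg coef_geom prednK // leqnn.
Qed.

Lemma geom_horner (d : nat) (x : F) : (x - 1) * (geom d).[x] = x ^+ d - 1.
Proof.
rewrite subrX1 /geom horner_sum; congr (_ * _).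
by apply: eq_bigr => i _; rewrite hornerXn.
Qed.

(** The binomial divides n!, which divides (p - 1)!, and Wilson's theorem applies. *)
Lemma bin_neq0_Fp (n m : nat) : (m <= n)%N -> (n < p)%N -> 'C(n, m)%:R != 0 :> F.
Proof.
move=> mn np; rewrite -(dvdn_pcharf (pchar_Fp p_prime)); apply/negP => pC.
have pn : (p %| n`!)%N by rewrite -(bin_fact mn) dvdn_mulr.
have : (p %| (p.-1)`!)%N.
  have nn : (p.-1 - (p.-1 - n) = n)%N by lia.
  by rewrite -(@ffact_fact p.-1 (p.-1 - n)) ?leq_subr // nn dvdn_mull.
have := Wilson (prime_gt1 p_prime); rewrite p_prime -addn1 => /esym W W'.
by move: W; rewrite dvdn_addr // dvdn1; have := prime_gt1 p_prime; case: p => [|[]].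
Qed.

(* Hermite's criterion: the coefficient of X^(p-1) in geom d ^+ k, read off after
   the substitution x -> 1/x as the coefficient of X^(k(d-1) - (p-1)), is a
   binomial coefficient that p does not divide. *)
Lemma geom_not_perm (d : nat) : (2 < d)%N -> (d < p)%N ->
  (forall k, (0 < k < p.-1)%N -> \sum_(x : F) (geom d).[x] ^+ k = 0) -> False.
Proof.
move=> d2 dp sum0; pose D := d.-1; have dD : d = D.+1 by rewrite prednK; lia.
(* The quotient (p - 1)/D rounded up: the least k for which [geom d ^+ k] has degree at least p -
   1. *)
pose k := ((p.-1 + D.-1) %/ D)%N.
have [k1 k2] : (p.-1 <= k * D)%N /\ (k * D < p.-1 + D)%N.
  have := divn_eq (p.-1 + D.-1) D; rewrite -/k.
  have : ((p.-1 + D.-1) %% D < D)%N by rewrite ltn_mod; lia.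
  by move: (_ %% _)%N => r; lia.
have k_ge2 : (1 < k)%N by rewrite ltnNge; apply/negP; case: k k1 {k2} => [|[|]] //; lia.
have k_lt : (k < p.-1)%N by nia.
(* The factor X^s brings the degree of [T] to 2(p - 1), so that T(1/x) is the k-th power of [geom d]
   at x, and it moves the coefficient of degree [e] to degree p - 1. *)
pose e := (k * D - p.-1)%N; have eD : (e < D)%N by rewrite /e; lia.
pose s := (p.-1 - e)%N; have s0 : (0 < s)%N by rewrite /s; lia.
have skD : (s + k * D = 2 * p.-1)%N by rewrite /s /e; lia.
have [sg gm] := @geom_monic d (ltnW (ltnW d2)).
have gkm : geom d ^+ k \is monic by rewrite monic_exp.
have sgk : size (geom d ^+ k) = (k * D).+1.
  have := size_exp (geom d) k; rewrite sg => E.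
  rewrite -[LHS]prednK ?E ?[(k * _)%N]mulnC // lt0n size_poly_eq0.
  exact: monic_neq0.
pose T := 'X^s * geom d ^+ k.
have T0 : T`_0 = 0 by rewrite coefXnM s0.
have sT : (size T <= (2 * p.-1).+1)%N.
  by rewrite /T size_Mmonic ?monic_neq0 ?monicXn // sgk size_polyXn -skD; lia.
have E : \sum_x T.[x] = \sum_(x : F | x != 0) (geom d).[x] ^+ k.
  rewrite (bigD1 0) //= hornerM hornerXn expr0n eqn0Ngt s0 mul0r add0r.
  rewrite (reindex_inj (@invr_inj F)) /=.
  rewrite [in LHS](eq_bigl (fun x => x != 0)) => [|x]; last by rewrite invr_eq0.
  apply: eq_bigr => x x0; rewrite hornerM hornerXn horner_exp.
  have gx : (geom d).[x^-1] = x^-1 ^+ D * (geom d).[x].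
    have [->|x1] := eqVneq x 1; first by rewrite invr1 expr1n mul1r.
    have x1' : x - 1 != 0 by rewrite subr_eq0.
    have x1'' : x^-1 - 1 != 0 by rewrite subr_eq0 invr_eq1.
    apply: (mulfI x1''); rewrite geom_horner; apply: (mulfI x1').
    transitivity (x^-1 ^+ D * (x^-1 - 1) * ((x - 1) * (geom d).[x])); last by ring.
    rewrite geom_horner dD !exprS !exprVn; field.
    by rewrite x0 expf_neq0.
  rewrite gx exprMn -exprM mulrA -exprD mulnC skD exprVn (@Fp_expr_modp1 _ _ 0) //.
    by rewrite expr0 invr1 mul1r.
  by rewrite modnMl mod0n.
have := sum0 k; rewrite k_lt (ltnW k_ge2) => /(_ isT).
(* The term 1 at x = 0 cancels the leading coefficient; the coefficient of degree [e] remains. *)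
rewrite (bigD1 0) //= -E (sum_horner T0 sT) -skD !coefXnM.
have -> : (p.-1 < s)%N = false by rewrite /s; lia.
have -> : (s + k * D < s)%N = false by lia.
have -> : (p.-1 - s = e)%N by rewrite /s; lia.
have -> : (s + k * D - s = k * D)%N by lia.
have -> : (geom d ^+ k)`_(k * D) = 1.
  by have := monicP gkm; rewrite lead_coefE sgk.
have -> : (geom d).[0] = 1 by rewrite horner_coef0 coef_geom (ltn_trans _ d2).
rewrite expr1n -[k in geom d ^+ k](prednK (ltnW k_ge2)) coef_geom_exp; last by lia.
move/eqP; rewrite opprD addrCA subrr addr0 oppr_eq0; apply/negP.
apply: bin_neq0_Fp; first exact: leq_addl.
by nia.
Qed.

(* (geom d).[x] is the slope of the chord of the graph of x^d through 1 and x; these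
   slopes are distinct because a line meets the graph at most twice. *)
Lemma planar_monomial_lt (d : nat) : (2 < d)%N -> (d < p)%N ->
  (forall a : F, a != 0 -> injective (fun x => (x + a) ^+ d - x ^+ d)) -> False.
Proof.
move=> d2 dp planar_d; apply: (geom_not_perm d2 dp).
(* The linear term only shifts each difference by the constant b a. *)
have cnt2 b z : cnt (fun x : F => x ^+ d + b * x) z <= 2.
  apply: planar_fp_cnt => // a a0 x y /= xy; apply: (planar_d a a0) => /=.
  apply: (addIr (b * a)).
  by transitivity ((x + a) ^+ d + b * (x + a) - (x ^+ d + b * x)); [ring | rewrite xy; ring].
pose q x := (geom d).[x] : F.
have q_inj x y : x != 1 -> y != 1 -> q x = q y -> x = y.
  move=> x1 y1 qxy; apply/eqP; apply: contraT => xy.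
  have : (2 < #|[pred x' : F | (x' ^+ d + - q x * x' == 1 - q x)%R]|)%N.
    have -> : 3%N = #|[:: 1%R : F; x; y]|.
      apply/esym/card_uniqP; rewrite /= !inE negb_or ![1 == _]eq_sym x1 y1 xy //.
    apply: subset_leq_card; apply/subsetP => t; rewrite !inE.
    have Q t' : t' ^+ d = 1 + (t' - 1) * q t' by rewrite geom_horner addrC subrK.
    case/or3P => /eqP->; first by rewrite expr1n; apply/eqP; ring.
      by rewrite Q; apply/eqP; ring.
    by rewrite Q qxy; apply/eqP; ring.
  by have := cnt2 (- q x) (1 - q x); rewrite cntE natz lez_nat leqNgt => /negP.
(* Sending 1 to a value [m] missed elsewhere gives a permutation [q']. Both [q] and [q'] sum to 0,
   so q(1) = m and [q] is itself a permutation. *)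
have [m mP] : exists m, forall x, x != 1 -> q x != m.
  have [m /forallP mP|all_hit] := pickP [pred m | [forall x, (x != 1) ==> (q x != m)]].
    by exists m => x; apply/implyP.
  have : (#|F| <= #|predC1 (1%R : F)|)%N.
    apply: leq_trans (leq_image_card q _).
    apply: subset_leq_card; apply/subsetP => m _.
    have := negbT (all_hit m); rewrite /= negb_forall => /existsP[x].
    by rewrite negb_imply negbK => /andP[x1 /eqP<-]; apply: image_f.
  by rewrite cardC1 card_Fp //; have := prime_gt0 p_prime; lia.
pose q' x := if x == 1 then m else q x.
have q'_inj : injective q'.
  move=> x y; rewrite /q'; case: eqVneq => [->|x1]; case: eqVneq => [->|y1] //.
  - by move=> qy; have := mP y y1; rewrite qy eqxx.
  - by move=> qx; have := mP x x1; rewrite qx eqxx.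
  - exact: q_inj.
have q'_sum (G : F -> F) : \sum_x G (q' x) = \sum_x G x.
  by rewrite [RHS](reindex_inj q'_inj).
have q_sum : \sum_x q x = 0.
  rewrite /q /geom; under eq_bigr => x _ do rewrite horner_sum.
  rewrite exchange_big big1 // => i _.
  under eq_bigr => x _ do rewrite hornerXn.
  have [->|i0] := posnP i.
    under eq_bigr => x _ do rewrite expr0.
    by rewrite sumr_const card_Fp // natF0.
  by apply: power_sum; rewrite gtnNdvd //; have := ltn_ord i; lia.
have m1 : q 1 = m.
  have E : \sum_x q' x = \sum_x q x.
    rewrite q_sum (q'_sum id) -[RHS](@power_sum 1) //.
    by rewrite gtnNdvd //; lia.
  move: E; rewrite (bigD1 1) // [RHS](bigD1 1) //= {1}/q' eqxx.
  rewrite (eq_bigr q) => [|x /negbTE x1]; last by rewrite /q' x1.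
  by move/addIr.
move=> k /andP[k0 kp]; rewrite (eq_bigr (fun x => q' x ^+ k)) => [|x _].
  by rewrite (q'_sum (fun x => x ^+ k)) power_sum // gtnNdvd.
by rewrite /q'; case: eqP => // ->; rewrite -m1.
Qed.

Lemma planar_monomial (d : nat) : (3 < p)%N -> (0 < d)%N ->
  (forall a : F, a != 0 -> injective (fun x => (x + a) ^+ d - x ^+ d)) ->
  forall x : F, x ^+ d = x ^+ 2.
Proof.
move=> p_gt3 d0 planar_d; pose m := ((d.-1 %% p.-1).+1)%N.
have mp : (m < p)%N by rewrite -[X in (_ < X)%N](prednK (prime_gt0 p_prime)) ltnS ltn_mod; lia.
have dm (x : F) : x ^+ d = x ^+ m.
  have [->|x0] := eqVneq x 0; first by rewrite !expr0n; case: (d) d0.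
  rewrite -(prednK d0) /m !exprS; congr (_ * _).
  by apply: Fp_expr_modp1; rewrite // modn_mod.
have planar_m a : a != 0 -> injective (fun x : F => (x + a) ^+ m - x ^+ m).
  by move=> a0 x y /= E; apply: (planar_d a a0); rewrite /= !dm.
move=> x; rewrite dm; case: (ltngtP m 2) => [m2|m2|-> //].
- have m1 : m = 1%N by move: m2; rewrite /m; lia.
  have E : 0 = 1 :> F by apply: (@planar_m 1 (oner_neq0 _)); rewrite /= m1 !expr1; ring.
  by have := oner_neq0 F; rewrite -E eqxx.
- by have := planar_monomial_lt m2 mp planar_m.
Qed.

End PlanarMonomial.

(** * Traces of planar functions and the oval *)

Section Lines.
Variables (p : nat) (p_prime : prime p).
Local Notation F := 'F_p.

Lemma linear_cnt (V : finLmodType F) (u : V -> F) (x0 : V) (z : F) :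
  (forall x y, u (x + y) = u x + u y) -> (forall l x, u (l *: x) = l * u x) ->
  u x0 != 0 -> p%:R * cnt u z = #|V|%:R.
Proof.
move=> uD uZ ux0.
have shift w : cnt u w = cnt u 0.
  pose y := (w / u x0) *: x0.
  have uy : u y = w by rewrite uZ divfK.
  rewrite -(@cnt_bij _ _ _ (fun x => x + y) u); last first.
    by exists (fun x => x - y) => x; rewrite ?addrK ?subrK.
  by apply: eq_cnt => x /=; rewrite uD uy -subr_eq0 addrK.
have := sum_cnt u; rewrite (eq_bigr (fun=> cnt u z)) => [|w _]; last by rewrite (shift w) (shift z).
by rewrite sum_const card_Fp.
Qed.

Lemma lines_le_cnt (V : finLmodType F) (h : V -> F) (n : nat) (x : 'I_n -> V) :
  (forall l v, h v = 0 -> h (l *: v) = 0) ->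
  (forall i, x i != 0) -> (forall i, h (x i) = 0) ->
  (forall (i j : 'I_n) (l : F), (i < j)%N -> x i <> l *: x j) ->
  (n * p.-1)%:R <= cnt h 0.
Proof.
move=> hZ x0 hx x_lines; rewrite cntE ler_nat.
have -> : (n * p.-1 = #|setX [set: 'I_n] [set~ (0%R : F)]|)%N.
  by rewrite cardsX cardsT card_ord cardsC1 card_Fp.
have inj : {in setX [set: 'I_n] [set~ (0%R : F)] &, injective (fun q => q.2 *: x q.1)}.
  move=> [i l] [j m] /[!inE] /= l0 m0 E.
  have [ij|ji|/val_inj ij] := ltngtP i j.
  - by case: (x_lines i j (l^-1 * m) ij); rewrite -scalerA -E scalerA mulVf ?scale1r.
  - by case: (x_lines j i (m^-1 * l) ji); rewrite -scalerA E scalerA mulVf ?scale1r.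
  subst j; congr (_, _); apply/eqP; rewrite -subr_eq0.
  have /eqP : (l - m) *: x i = 0 by rewrite scalerBl E subrr.
  by rewrite scaler_eq0 (negbTE (x0 i)) orbF.
rewrite -(card_in_imset inj); apply: subset_leq_card; apply/subsetP => v.
by case/imsetP=> -[i l] _ ->; rewrite inE hZ.
Qed.

End Lines.

Section AbsoluteTrace.
Variables (p : nat) (p_prime : prime p) (p_gt2 : (2 < p)%N).
Variables (L : splittingFieldType 'F_p) (dimL : \dim {:L} = 2%N).
Local Notation F := 'F_p.
Local Notation T := (@abstrace _ L).

Lemma abstraceD x y : T (x + y) = T x + T y.
Proof. by rewrite /abstrace raddfD linearD. Qed.

Lemma abstraceZ l x : T (l *: x) = l * T x.
Proof.
rewrite /abstrace -[RHS]/(l *: _) -linearZ; congr (coord _ _ _).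
by rewrite /galTrace scaler_sumr; apply: eq_bigr => s _; rewrite linearZ.
Qed.

Lemma abstraceB x y : T (x - y) = T x - T y.
Proof. by rewrite -scaleN1r abstraceD abstraceZ mulN1r. Qed.

Lemma abstrace1 : T 1 != 0.
Proof.
apply/eqP => T1; have := abstraceE (1 : L); rewrite T1 scale0r /galTrace.
under eq_bigr => s _ do rewrite rmorph1.
rewrite sumr_const -galois_dim ?finField_galois ?sub1v // dimv1 divn1 dimL => /esym/eqP.
by rewrite -[1 *+ 2]scaler_nat scaler_eq0 oner_eq0 orbF (negbTE (two_neq0 p_prime p_gt2)).
Qed.

Lemma card_L : #|finvect_type L| = (p ^ 2)%N.
Proof.
have := card_vspace {:finvect_type L}; rewrite card_Fp // dimL => <-.
by apply: eq_card => x; rewrite memvf.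
Qed.

Lemma abstrace_cnt (c : L) z :
  c != 0 -> cnt (fun x : finvect_type L => T (c * x)) z = p%:R.
Proof.
move=> c0; have p0 : p%:R != 0 :> int by rewrite natz; have := prime_gt0 p_prime; lia.
apply: (mulfI p0); rewrite (@linear_cnt _ p_prime (finvect_type L) _ (c^-1)).
- by rewrite card_L natrX expr2.
- by move=> x y; rewrite mulrDr abstraceD.
- by move=> l x; rewrite -scalerAr abstraceZ.
- by rewrite mulfV // abstrace1.
Qed.

Lemma abstrace_kernel (c x y : L) : c != 0 -> x != 0 -> y != 0 ->
  T (c * x) = 0 -> T (c * y) = 0 -> exists l : F, x = l *: y.
Proof.
move=> c0 x0 y0 cx cy.
have [/existsP[l /eqP xl]|nol] := boolP [exists l : F, x == l *: y]; first by exists l.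
have : (2 * p.-1)%:R <= cnt (fun x : finvect_type L => T (c * x)) 0.
  apply: (@lines_le_cnt _ p_prime (finvect_type L) _ _ (fun i : 'I_2 => if val i == 0%N then x else y)).
  - by move=> l v; rewrite -scalerAr abstraceZ => ->; rewrite mulr0.
  - by case=> -[|[]].
  - by case=> -[|[]].
  - case=> -[|[|//]] // i [[|[|//]] // j] l _ /= xl.
    by case/negP: nol; apply/existsP; exists l; apply/eqP.
by rewrite abstrace_cnt // ler_nat; have := p_gt2; lia.
Qed.

End AbsoluteTrace.

Lemma sum_ord3 (V : nmodType) (G : 'I_3 -> V) : \sum_i G i = G 0 + G 1 + G 2%:R.
Proof.
rewrite !big_ord_recr big_ord0 /= add0r.
by congr (_ + _ + _); congr G; apply: val_inj.
Qed.

Lemma collinear_functional (K : finFieldType) (v : 'I_3 -> 'rV[K]_3) :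
  collinear <[v 0]> <[v 1]> <[v 2%:R]> ->
  exists2 w : 'rV[K]_3, w != 0 & forall i, \sum_j w 0 j * v i 0 j = 0.
Proof.
move=> [l [dim_l [l0 l1 l2]]].
have lv i : v i \in l.
  by case: i => -[|[|[|//]]] ?; rewrite memvE;
    [move: l0 | move: l1 | move: l2]; congr (<[v _]> <= l)%VS; apply: val_inj.
pose M := \matrix_(i, j) v i 0 j.
have : \det M^T == 0.
  rewrite det_tr; apply: contraT => detM.
  have Mu : M \in unitmx by rewrite unitmxE unitfE.
  suff : (fullv <= l)%VS by move/dimvS; rewrite dimvf dim_l dim_matrix.
  apply/subvP => w _; rewrite -(mulmxKV Mu w) mulmx_sum_row.
  apply: rpred_sum => i _; apply: rpredZ; suff -> : row i M = v i by [].
  by apply/rowP => j; rewrite !mxE.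
case/det0P => w w0 wM; exists w => // i.
have := congr1 (fun A : 'rV_3 => A 0 i) wM; rewrite !mxE => wMi.
by rewrite -[RHS]wMi; apply: eq_bigr => j _; rewrite !mxE.
Qed.

Section PlanarOval.
Variables (p : nat) (p_prime : prime p) (p_gt3 : (3 < p)%N).
Variables (L : splittingFieldType 'F_p) (dimL : \dim {:L} = 2%N).
Local Notation F := 'F_p.
Local Notation T := (@abstrace _ L).
Variables (beta : L) (beta_neq0 : beta != 0) (beta_pow : beta ^+ (p - 1)%N = -1).
Variables (f : L -> L) (f_planar : planar f) (d : nat) (d_gt0 : (0 < d)%N).
Hypothesis f_hom : forall (l : F) (x : L), f (l *: x) = l ^+ d *: f x.
Hypothesis f1 : f 1 = 1.
Variables (t : L) (t_neq0 : t != 0).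

Let p_gt2 : (2 < p)%N. Proof. exact: ltnW. Qed.

Lemma two_neq0L : 2%:R != 0 :> L.
Proof. by rewrite -scaler_nat scaler_eq0 oner_eq0 orbF two_neq0. Qed.

Lemma planar_homZ (l : F) (x : L) : f (l *: x) = l ^+ 2 *: f x.
Proof.
rewrite f_hom (@planar_monomial p p_prime p_gt2 d) // => a a0 u v /= uv.
have aL : a *: (1 : L) != 0 by rewrite scaler_eq0 oner_eq0 orbF.
have D (y : F) : f (y *: 1 + a *: 1) - f (y *: 1) - f (a *: 1)
    = ((y + a) ^+ d - y ^+ d - a ^+ d) *: 1.
  by rewrite -scalerDl !f_hom f1 !scalerBl.
have /(bij_inj (f_planar aL)) : f (u *: 1 + a *: 1) - f (u *: 1) - f (a *: 1)
    = f (v *: 1 + a *: 1) - f (v *: 1) - f (a *: 1) by rewrite !D uv.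
move/eqP; rewrite -subr_eq0 -scalerBl scaler_eq0 oner_eq0 orbF subr_eq0.
by move/eqP.
Qed.

Lemma planar_hom0 : f 0 = 0.
Proof. by have := planar_homZ 0 0; rewrite expr0n !scale0r. Qed.

Lemma planar_even x : f (- x) = f x.
Proof. by rewrite -scaleN1r planar_homZ sqrrN expr1n scale1r. Qed.

Lemma planar_eq x y : f x = f y -> x = y \/ x = - y.
Proof.
move=> fxy; have [->|xy] := eqVneq x y; first by left.
right; have a0 : y - x != 0 by rewrite subr_eq0 eq_sym.
have n2 := two_neq0L.
pose h := (y - x) / 2%:R.
have hh : y - x = h + h by rewrite -mulr2n -mulr_natr divfK.
have E : x = - h.
  apply: (bij_inj (f_planar a0)) => /=.
  by rewrite [x + _]addrC subrK [in - h + _]hh addKr planar_even fxy !subrr.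
by rewrite -(subrK x y) hh {2}E addrK.
Qed.

Lemma planar_neq0 x : x != 0 -> f x != 0.
Proof.
move=> x0; apply: contra_neq x0 => fx.
by have [|->|->] := @planar_eq x 0; rewrite ?oppr0 // fx planar_hom0.
Qed.

Lemma planar_trace_bent (c : L) (b : F) : c != 0 ->
  bent (V := finvect_type L) (fun x => T (c * f x) + b * T (t * x)).
Proof.
move=> c0 a a0 z.
rewrite -(@abstrace_cnt _ p_prime p_gt2 L dimL c (z - (T (c * f a) + b * T (t * a))) c0).
rewrite -(@cnt_bij (finvect_type L) (finvect_type L) _
  (fun x : L => f (x + a) - f x - f a) (fun x : L => T (c * x))); last exact: f_planar.
apply: eq_cnt => x /=; rewrite -subr_eq0 -[RHS]subr_eq0; congr (_ == 0).
rewrite !mulrBr !abstraceB mulrDr abstraceD; ring.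
Qed.

Lemma planar_trace_cnt (a : F) (c : L) : c != 0 ->
  cnt (fun x : finvect_type L => T (c * f x) - a * T (t * x) ^+ 2) 0 <= p%:R * 2.
Proof.
move=> c0; apply: (@bent_conic_cnt _ p_prime p_gt2 (finvect_type L)
  (fun x => T (c * f x)) (fun x => T (t * x))).
- exact: card_L.
- by move=> l x; rewrite planar_homZ -scalerAr abstraceZ.
- by move=> l x; rewrite -scalerAr abstraceZ.
- by move=> b; apply: planar_trace_bent.
Qed.

Lemma beta_notin_Fp (l : F) : beta <> l *: 1.
Proof.
move=> bl; have l0 : l != 0.
  by apply: contra_neq beta_neq0 => l0; rewrite bl l0 scale0r.
have : (1 : L) = -1.
  by rewrite -beta_pow bl exprZn expr1n subn1 Fp_expr_p1 // scale1r.
move/eqP; rewrite -subr_eq0 opprK; apply/negP; exact: two_neq0L.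
Qed.

Lemma trace_pair_eq0 y : T y = 0 -> T (beta * y) = 0 -> y = 0.
Proof.
move=> Ty Tby; apply/eqP; apply: contraT => y0.
have [||l bl] := @abstrace_kernel _ p_prime p_gt2 L dimL y beta 1 y0 beta_neq0 (oner_neq0 _).
- by rewrite mulrC.
- by rewrite mulr1.
by case: (beta_notin_Fp bl).
Qed.

Definition oval_vec (x : L) : 'rV[F]_3 :=
  \row_(i < 3) [:: T (t * x) ^+ 2; T (f x); T (beta * f x)]`_i.

Lemma oval_vecE (x : L) : [/\ oval_vec x 0 0 = T (t * x) ^+ 2,
  oval_vec x 0 1 = T (f x) & oval_vec x 0 2%:R = T (beta * f x)].
Proof. by split; rewrite mxE. Qed.

Lemma oval_vecZ l x : oval_vec (l *: x) = l ^+ 2 *: oval_vec x.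
Proof.
apply/rowP => i; rewrite !mxE planar_homZ -!scalerAr !abstraceZ exprMn.
by case: i => -[|[|[|//]]].
Qed.

Lemma oval_vec_neq0 x : x != 0 -> oval_vec x != 0.
Proof.
move=> /planar_neq0; apply: contra_neq => v0; have [_ v1 v2] := oval_vecE x.
by apply: trace_pair_eq0; rewrite -?v1 -?v2 v0 mxE.
Qed.

Lemma oval_vec_line x y : x != 0 -> y != 0 ->
  (<[oval_vec x]> = <[oval_vec y]>)%VS -> exists l : F, x = l *: y.
Proof.
move=> x0 y0 xy; have : oval_vec x \in <[oval_vec y]>%VS by rewrite -xy memv_line.
case/vlineP => k vxy.
have [x1 x2 x3] := oval_vecE x; have [y1 y2 y3] := oval_vecE y.
have e i : oval_vec x 0 i = k * oval_vec y 0 i by rewrite vxy mxE.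
rewrite e y1 in x1; rewrite e y2 in x2; rewrite e y3 in x3.
have fxy : f x = k *: f y.
  apply/eqP; rewrite -subr_eq0; apply/eqP; apply: trace_pair_eq0.
    by rewrite abstraceB abstraceZ x2 subrr.
  by rewrite mulrBr abstraceB -scalerAr abstraceZ x3 subrr.
have [ty0|ty0] := eqVneq (T (t * y)) 0.
  apply: (@abstrace_kernel _ p_prime p_gt2 L dimL t) => //.
  by apply/eqP; rewrite -sqrf_eq0 -x1 ty0 expr0n mulr0.
pose m := T (t * x) / T (t * y).
have km : k = m ^+ 2 by rewrite /m expr_div_n -x1 mulfK // expf_neq0.
have : f x = f (m *: y) by rewrite planar_homZ -km.
by case/planar_eq => ->; [exists m | exists (- m); rewrite scaleNr].
Qed.

Lemma card_trace_points : #|trace_points beta f t| = p.+1.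
Proof.
pose D := [pred x : finvect_type L | x != 0].
pose P (x : finvect_type L) := <[oval_vec x]>%VS.
have cardD : #|D| = (p.-1 * p.+1)%N.
  have -> : #|D| = #|predC1 (0 : finvect_type L)| by apply: eq_card.
  rewrite cardC1 card_L //; have := prime_gt0 p_prime; nia.
have fiber x : x \in D -> #|[pred y in D | P y == P x]| = p.-1.
  move=> x0; have inj : injective (fun l : F => l *: (x : L)).
    move=> l m /eqP; rewrite -subr_eq0 -scalerBl scaler_eq0 (negbTE x0) orbF subr_eq0.
    by move/eqP.
  have <- : #|[set (l *: (x : L) : finvect_type L) | l in predC1 (0 : F)]| = p.-1.
    by rewrite card_imset // cardC1 card_Fp.
  apply: eq_card => y; rewrite !inE; apply/andP/imsetP.
    move=> [y0 /eqP /(oval_vec_line y0 x0)[l yl]]; exists l => //.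
    by rewrite inE; apply: contra_neq y0 => l0; rewrite yl l0 scale0r.
  move=> [l /[!inE] l0 ->]; split; first by rewrite scaler_eq0 negb_or l0.
  rewrite /P oval_vecZ; apply/eqP/vspaceP => v; apply/vlineP/vlineP => -[k ->].
    by exists (k * l ^+ 2); rewrite scalerA.
  by exists (k / l ^+ 2); rewrite scalerA divfK // expf_neq0.
have : #|D| = (p.-1 * #|trace_points beta f t|)%N.
  have := @partition_big_imset _ 0%N addn _ _ P D (fun=> 1%N); rewrite sum1_card => ->.
  rewrite (eq_bigr (fun=> p.-1)).
    rewrite sum_nat_const mulnC; congr (_ * _)%N; apply: eq_card => Q.
    by apply/imsetP/imsetP; case=> x x0 ->; exists x; move: x0; rewrite ?inE.
  move=> Q /imsetP[x x0 ->]; rewrite -(fiber x x0) -sum1_card.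
  by apply: eq_bigl => y; rewrite !inE.
rewrite cardD => /eqP; rewrite eqn_pmul2l => [/eqP //|].
by have := p_gt2; lia.
Qed.

Lemma trace_points_not_collinear x y z : x != 0 -> y != 0 -> z != 0 ->
  (<[oval_vec x]> != <[oval_vec y]>)%VS -> (<[oval_vec x]> != <[oval_vec z]>)%VS ->
  (<[oval_vec y]> != <[oval_vec z]>)%VS ->
  ~ collinear <[oval_vec x]> <[oval_vec y]> <[oval_vec z]>.
Proof.
move=> x0 y0 z0 xy xz yz coll.
pose r (i : 'I_3) : finvect_type L := [:: x; y; z]`_i.
have [w w0 wr] := @collinear_functional _ (fun i => oval_vec (r i)) coll.
have r0 i : r i != 0 by case: i => -[|[|[|//]]].
have line_neq u v (l : F) : u != 0 ->
    (<[oval_vec u]> != <[oval_vec v]>)%VS -> u <> l *: v.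
  move=> u0 /eqP uv ul; apply: uv; rewrite ul oval_vecZ.
  have l0 : l != 0 by apply: contra_neq u0 => l0; rewrite ul l0 scale0r.
  apply/vspaceP => s; apply/vlineP/vlineP => -[k ->].
    by exists (k * l ^+ 2); rewrite scalerA.
  by exists (k / l ^+ 2); rewrite scalerA divfK // expf_neq0.
have r_lines (i j : 'I_3) (l : F) : (i < j)%N -> r i <> l *: r j.
  by case: i => -[|[|[|//]]] ?; case: j => -[|[|[|//]]] ? //= _; apply: line_neq.
pose c := w 0 1 *: 1 + w 0 2%:R *: beta.
have wE i : T (c * f (r i)) - (- w 0 0) * T (t * r i) ^+ 2 = 0.
  rewrite -[RHS](wr i) sum_ord3; have [-> -> ->] := oval_vecE (r i).
  by rewrite mulrDl -!scalerAl mul1r abstraceD !abstraceZ; ring.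
have three (h : finvect_type L -> F) : (forall l v, h v = 0 -> h (l *: v) = 0) ->
   (forall i, h (r i) = 0) -> cnt h 0 <= p%:R * 2 -> False.
  move=> hZ hr; have := lines_le_cnt p_prime hZ r0 hr r_lines.
  move=> H1 H2; have := le_trans H1 H2; rewrite -natrM ler_nat.
  by move: p_gt3; clear; lia.
have [c0|c0] := eqVneq c 0; last first.
  apply: (three _ _ wE (planar_trace_cnt _ c0)) => l v /=.
  rewrite planar_homZ -!scalerAr !abstraceZ => E.
  by rewrite -[RHS](mulr0 (l ^+ 2)) -E; ring.
have w2 : w 0 2%:R = 0.
  apply/eqP; apply: contraT => w2; case: (@beta_notin_Fp (- (w 0 1 / w 0 2%:R))).
  apply: (scalerI w2); rewrite scalerA mulrN mulrC divfK // scaleNr.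
  by apply/eqP; rewrite -addr_eq0 addrC -/c c0.
have w1 : w 0 1 = 0.
  by have /eqP := c0; rewrite /c w2 scale0r addr0 scaler_eq0 oner_eq0 orbF => /eqP.
have w00 : w 0 0 != 0.
  apply: contra_neq w0 => w00; apply/rowP => i; rewrite mxE.
  case: i => -[|[|[|//]]] ?; [rewrite -[RHS]w00 | rewrite -[RHS]w1 | rewrite -[RHS]w2];
  by congr (w 0 _); apply: val_inj.
apply: (three (fun v : L => T (t * v))).
- by move=> l v vt; rewrite -scalerAr abstraceZ vt mulr0.
- move=> i; have := wr i; rewrite sum_ord3; have [-> _ _] := oval_vecE (r i).
  rewrite w1 w2 !mul0r !addr0 => /eqP.
  by rewrite mulf_eq0 (negbTE w00) sqrf_eq0 => /eqP.
- by rewrite (abstrace_cnt p_prime p_gt2 dimL _ t_neq0) -natrM ler_nat leq_pmulr.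
Qed.

Lemma trace_points_oval : is_oval (trace_points beta f t).
Proof.
split.
- by move=> _ /imsetP[x /[!inE] x0 ->]; rewrite dim_vline oval_vec_neq0.
- by rewrite card_trace_points card_Fp.
- move=> _ _ _ /imsetP[x /[!inE] x0 ->] /imsetP[y /[!inE] y0 ->] /imsetP[z /[!inE] z0 ->].
  exact: trace_points_not_collinear.
Qed.

End PlanarOval.

Unset Implicit Arguments.

Theorem theorem3p1 (p : nat) (p_prime : prime p) (p_ge11 : (11 <= p)%N)
    (L : splittingFieldType 'F_p) (dimL : \dim {:L} = 2%N)
    (beta : L) (beta_neq0 : beta != 0) (beta_pow : beta ^+ (p - 1)%N = -1)
    (gamma : L) (gamma_prim : (p ^ 2 - 1)%N.-primitive_root gamma)
    (f : L -> L) (f_planar : planar f)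
    (d : nat) (d_gt0 : (0 < d)%N)
    (f_hom : forall (lambda : 'F_p) (x : L),
       f (lambda *: x) = lambda ^+ d *: f x)
    (f1 : f 1 = 1) (f_beta : f beta = beta ^+ 2)
    (f_gamma : f gamma = gamma ^+ 2)
    (t : L) (t_neq0 : t != 0) :
  is_oval (trace_points beta f t).
Proof.
apply: (trace_points_oval p_prime _ dimL beta_neq0 beta_pow f_planar d_gt0 f_hom f1 t_neq0).
exact: leq_trans p_ge11.
Qed.
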